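(* Let $\mathbf{G}$ be a $\Sigma$-structure, $\mathscr{M}$ a minion, $\mathcal{D}$ a finite description over $\mathscr{M}$, $\mathcal{I}$ a $\Sigma$-interpretation over $\mathscr{M}$, and $h\ge r$ natural numbers. Suppose that (1) there is a finite $\Sigma$-structure $\mathbf{T}$ with $\mathbf{G}\to\mathbf{T}$ for which no homomorphism $\mathbf{G}\to\mathbf{T}$ is computable, (2) $\mathcal{I}$ is internal at arity $h$ w.r.t. $\mathcal{D}$, (3) $\mathbf{S}_\mathcal{I}$ is finitely equivalent to $\mathbf{G}$, (4) there is a computable homomorphism $\mathbf{G}\to\mathbf{S}_\mathcal{I}$, and (5) $r\ge\mathrm{ar}(Q)$ for every $Q\in\mathcal{D}$ and for $Q=U^\mathcal{I}$. Then there exists a finite template $(\mathbf{K}^h_r,\mathbf{B})$ such that $\mathscr{M}\to\mathrm{Pol}(\mathbf{K}^h_r,\mathbf{B})$ but there is no computable minion homomorphism $\mathscr{M}\to\mathrm{Pol}(\mathbf{K}^h_r,\mathbf{B})$.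
   Context: Minions: disjoint sets $\mathscr{M}(n)$ with maps $f\mapsto f^\pi\in\mathscr{M}(m)$ for $\pi:[n]\to[m]$, $f^{\mathrm{id}}=f$, $f^{\pi_1\circ\pi_2}=(f^{\pi_2})^{\pi_1}$; homomorphisms preserve arity and minoring; a partial homomorphism up to arity $h$, $\mathscr{M}\rightharpoonup_h\mathscr{N}$, is an arity-preserving map defined exactly on elements of arity at most $h$ and commuting with minoring. $\mathrm{Pol}(\mathbf{A},\mathbf{B})$: $n$-ary elements are homomorphisms $\mathbf{A}^n\to\mathbf{B}$, $f^\pi(\mathbf{b})=f(\mathbf{b}\circ\pi)$. Computability of maps between countable sets refers to some fixed implicit encodings by finite strings. Descriptions: a property is a subset $P\subseteq\mathscr{M}(n)$; a description $\mathcal{D}$ is a set of properties; $f\sim_\mathcal{D}g$ iff for all $P\in\mathcal{D}$ and $\pi:[n]\to[\mathrm{ar}(P)]$, $f^\pi\in P\iff g^\pi\in P$; $\mathscr{M}/\mathcal{D}$ is the quotient minion. $Q$ is $\mathcal{D}$-stable if it is a union of $\sim_\mathcal{D}$-classes, and internal at arity $h$ w.r.t. $\mathcal{D}$ if $\mathcal{D}$-stable and every partial homomorphism $F:\mathscr{M}\rightharpoonup_h\mathscr{M}/\mathcal{D}$ satisfies $F(Q)\subseteq Q/\mathcal{D}$. A $\Sigma$-interpretation $\mathcal{I}$ over $\mathscr{M}$: properties $U^\mathcal{I}$, $R^\mathcal{I}$ ($R\in\Sigma$) and maps $\Pi^\mathcal{I}_{R,i}:[\mathrm{ar}(R^\mathcal{I})]\to[\mathrm{ar}(U^\mathcal{I})]$;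 internal at arity $h$ if all its properties are. $\mathbf{S}_\mathcal{I}$: universe $U^\mathcal{I}$, $(f_1,\dots,f_{\mathrm{ar}(R)})\in R^{S_\mathcal{I}}$ iff some $g\in R^\mathcal{I}$ has $g^{\Pi^\mathcal{I}_{R,i}}=f_i$ for all $i$. Finitely equivalent: every finite structure maps into one iff into the other. $\mathbf{K}^h_r$ ($h\ge r$): one relation symbol of arity $m=r^h$, universe $[r]$, relation $\{(\pi_1(i),\dots,\pi_m(i)):i\in[h]\}$, $\pi_1,\dots,\pi_m$ the lexicographic enumeration of $[r]^{[h]}$. *)

(* Defs.v *)
From HB Require Import structures.
From mathcomp Require Import all_boot.
From mathcomp Require Import boolp classical_sets cardinality.

Set Implicit Arguments.
Unset Strict Implicit.
Unset Printing Implicit Defensive.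

Local Open Scope classical_set_scope.

(* Kleene's partial recursive functions.  In [PrimRec f g] the recursion
   variable is the first argument, and [g] receives the counter, the previous
   value and the parameters, in this order. *)
Inductive precfun : nat -> Type :=
| Zero n : precfun n
| Succ : precfun 1
| Proj n (i : 'I_n) : precfun n
| Comp m n (f : precfun m) (g : 'I_m -> precfun n) : precfun n
| PrimRec n (f : precfun n) (g : precfun n.+2) : precfun n.+1
| Minimize n (f : precfun n.+1) : precfun n.

(* [computes e v y]: the evaluation of [e] on [v] terminates with value [y].
   In the case of [PrimRec], [t] is the list of successive values. *)
Fixpoint computes n (e : precfun n) : n.-tuple nat -> nat -> Prop :=
  match e in precfun n return n.-tuple nat -> nat -> Prop with
  | Zero _ => fun _ y => y = 0
  | Succ => fun v y => y = (thead v).+1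
  | Proj _ i => fun v y => y = tnth v i
  | Comp m _ f g => fun v y =>
      exists2 w : m.-tuple nat,
        forall i, computes (g i) v (tnth w i) & computes f w y
  | PrimRec _ f g => fun v y =>
      exists t : nat -> nat,
        [/\ computes f [tuple of behead v] (t 0),
            forall k, k < thead v ->
              computes g [tuple of k :: t k :: behead v] (t k.+1)
          & y = t (thead v)]
  | Minimize _ f => fun v y =>
      computes f [tuple of y :: v] 0 /\
      forall k, k < y -> exists z, computes f [tuple of k :: v] z.+1
  end.

(* Computability of [f] relative to encodings of its domain and codomain.  The
   program may behave arbitrarily on numbers that encode no element of [X]. *)
Definition computable (X Y : Type) (codeX : X -> nat) (codeY : Y -> nat)
    (f : X -> Y) : Prop :=
  exists e : precfun 1, forall x, computes e [tuple codeX x] (codeY (f x)).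

Record signature := Signature { symbol : Type; sym_ar : symbol -> nat }.

Definition structure (S : signature) (A : Type) : Type :=
  forall R : symbol S, set ('I_(sym_ar R) -> A).

Definition is_hom (S : signature) (A B : Type)
    (SA : structure S A) (SB : structure S B) (f : A -> B) : Prop :=
  forall (R : symbol S) (t : 'I_(sym_ar R) -> A), SA R t -> SB R (f \o t).

Definition maps_to (S : signature) (A B : Type)
    (SA : structure S A) (SB : structure S B) : Prop :=
  exists f : A -> B, is_hom SA SB f.

Definition finitely_equivalent (S : signature) (A B : Type)
    (SA : structure S A) (SB : structure S B) : Prop :=
  forall (X : finType) (SX : structure S X), maps_to SX SA <-> maps_to SX SB.

Definition power (S : signature) (A : Type) (SA : structure S A) (n : nat) :
    structure S ('I_n -> A) :=
  fun R t => forall i : 'I_n, SA R (fun j => t j i).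

Arguments power {S A} SA n R : rename.

(* Arities are positive: this is rendered by requiring that there is no element
   of arity 0. *)
Record minion := Minion {
  elt :> nat -> Type;
  minor : forall n m, ('I_n -> 'I_m) -> elt n -> elt m;
  elt_gt0 : forall n, elt n -> 0 < n;
  minor_id : forall n (f : elt n), minor id f = f;
  minor_comp : forall n m p (p1 : 'I_m -> 'I_p) (p2 : 'I_n -> 'I_m) (f : elt n),
    minor (p1 \o p2) f = minor p1 (minor p2 f) }.

Arguments minor {m0} [n m].

Definition is_minion_hom (M N : minion) (F : forall n, M n -> N n) : Prop :=
  forall n m (p : 'I_n -> 'I_m) (f : M n), F m (minor p f) = minor p (F n f).

Definition is_partial_hom (h : nat) (M N : minion)
    (F : forall n, n <= h -> M n -> N n) : Prop :=
  forall n m (hn : n <= h) (hm : m <= h) (p : 'I_n -> 'I_m) (f : M n),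
    F m hm (minor p f) = minor p (F n hn f).

Section Pol.
Variables (S : signature) (A B : Type) (SA : structure S A) (SB : structure S B).

Definition pol (n : nat) : Type :=
  {f : ('I_n -> A) -> B | 0 < n /\ is_hom (power SA n) SB f}.

Fact pol_minor_subproof n m (p : 'I_n -> 'I_m) (f : pol n) :
  0 < m /\ is_hom (power SA m) SB (fun b => sval f (b \o p)).
Proof.
case: f => f [n0 fP]; split=> [|R t tP].
  exact: leq_trans (ltn_ord (p (Ordinal n0))).
by apply: (fP R (fun j => t j \o p)) => i; apply: tP.
Qed.

Definition pol_minor n m (p : 'I_n -> 'I_m) (f : pol n) : pol m :=
  exist _ (fun b => sval f (b \o p)) (pol_minor_subproof p f).

Fact pol_gt0 n (f : pol n) : 0 < n.
Proof. by case: f => f []. Qed.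

Fact pol_minor_id n (f : pol n) : pol_minor id f = f.
Proof. by case: f => f fP; apply: eq_exist. Qed.

Fact pol_minor_comp n m q (p1 : 'I_m -> 'I_q) (p2 : 'I_n -> 'I_m) (f : pol n) :
  pol_minor (p1 \o p2) f = pol_minor p1 (pol_minor p2 f).
Proof. by case: f => f fP; apply: eq_exist. Qed.

Definition Pol : minion := Minion pol_gt0 pol_minor_id pol_minor_comp.

End Pol.

(* A polymorphism of a finite template is encoded by its arity and its table. *)
Definition pol_code (S : signature) (A B : finType)
    (SA : structure S A) (SB : structure S B) (f : {n & Pol SA SB n}) : nat :=
  let: existT n g := f in
  pickle (n, pickle [ffun a : {ffun 'I_n -> A} => sval g a]).

Definition computable_minion_map (M N : minion)
    (codeM : {n & M n} -> nat) (codeN : {n & N n} -> nat)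
    (F : forall n, M n -> N n) : Prop :=
  computable codeM codeN (fun f => existT _ (projT1 f) (F _ (projT2 f))).

Record property (M : minion) :=
  Property { prop_ar : nat; prop_set :> set (M prop_ar) }.

Arguments prop_set {M} p _ : rename.

Definition description (M : minion) : Type := set (property M).

Section Quotient.
Variables (M : minion) (D : description M).

Definition deq n (f g : M n) : Prop :=
  forall P : property M, D P -> forall p : 'I_n -> 'I_(prop_ar P),
    prop_set P (minor p f) <-> prop_set P (minor p g).

Definition dclass n (f : M n) : set (M n) := [set g | deq f g].

Definition quot (n : nat) : Type := {C : set (M n) | range (@dclass n) C}.

Definition qproj n (f : M n) : quot n :=
  exist _ (dclass f) (ex_intro2 _ _ f I erefl).

Fact deq_refl n (f : M n) : deq f f.
Proof. by []. Qed.

Fact deq_sym n (f g : M n) : deq f g -> deq g f.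
Proof. by move=> fg P DP p; split=> /(fg P DP p). Qed.

Fact deq_trans n (f g k : M n) : deq f g -> deq g k -> deq f k.
Proof.
by move=> fg gk P DP p; split=> [/(fg P DP p)/(gk P DP p)|/(gk P DP p)/(fg P DP p)].
Qed.

Fact deq_minor n m (p : 'I_n -> 'I_m) (f g : M n) :
  deq f g -> deq (minor p f) (minor p g).
Proof. by move=> fg P DP q; rewrite -!minor_comp; apply: fg. Qed.

Definition class_minor n m (p : 'I_n -> 'I_m) (C : set (M n)) : set (M m) :=
  \bigcup_(f in C) dclass (minor p f).

Fact class_minor_dclass n m (p : 'I_n -> 'I_m) (f : M n) :
  class_minor p (dclass f) = dclass (minor p f).
Proof.
apply/seteqP; split=> [g [f' ff' f'g]|g fg]; last by exists f.
exact: deq_trans (deq_minor p ff') f'g.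
Qed.

Fact quot_minor_subproof n m (p : 'I_n -> 'I_m) (C : quot n) :
  range (@dclass m) (class_minor p (sval C)).
Proof.
by case: C => C [f ? fC] /=; rewrite -fC class_minor_dclass; exists (minor p f).
Qed.

Definition quot_minor n m (p : 'I_n -> 'I_m) (C : quot n) : quot m :=
  exist _ (class_minor p (sval C)) (quot_minor_subproof p C).

Fact quot_gt0 n (C : quot n) : 0 < n.
Proof. by case: C => C [f _ _]; apply: elt_gt0 f. Qed.

Fact quot_minor_id n (C : quot n) : quot_minor id C = C.
Proof.
by case: C => C [f ? fC]; apply: eq_exist; rewrite /= -fC class_minor_dclass minor_id.
Qed.

Fact quot_minor_comp n m q (p1 : 'I_m -> 'I_q) (p2 : 'I_n -> 'I_m) (C : quot n) :
  quot_minor (p1 \o p2) C = quot_minor p1 (quot_minor p2 C).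
Proof.
case: C => C [f ? fC]; apply: eq_exist.
by rewrite /= -fC !class_minor_dclass minor_comp.
Qed.

Definition quotient : minion := Minion quot_gt0 quot_minor_id quot_minor_comp.

Definition stable (Q : property M) : Prop :=
  exists2 C : set (set (M (prop_ar Q))),
    C `<=` range (@dclass (prop_ar Q)) & prop_set Q = \bigcup_(X in C) X.

(* F(Q) only makes sense when the arity of Q is at most h. *)
Definition internal (h : nat) (Q : property M) : Prop :=
  stable Q /\
  exists hQ : prop_ar Q <= h,
    forall F : forall n, n <= h -> M n -> quotient n, is_partial_hom F ->
      F (prop_ar Q) hQ @` Q `<=` @qproj (prop_ar Q) @` Q.

End Quotient.

Record interpretation (S : signature) (M : minion) := Interpretation {
  iU : property M;
  iR : symbol S -> property M;
  iPi : forall R : symbol S,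
    'I_(sym_ar R) -> 'I_(prop_ar (iR R)) -> 'I_(prop_ar iU) }.

Section Interpretation.
Variables (S : signature) (M : minion) (I : interpretation S M).

Definition internal_interp (D : description M) (h : nat) : Prop :=
  internal D h (iU I) /\ forall R : symbol S, internal D h (iR I R).

Definition interp_univ : Type := {f : M (prop_ar (iU I)) | prop_set (iU I) f}.

Definition interp_struct : structure S interp_univ :=
  fun R t => exists2 g : M (prop_ar (iR I R)),
    prop_set (iR I R) g & forall i, minor (iPi (i := I) i) g = sval (t i).

(* Elements of [interp_univ] are encoded as elements of [M]. *)
Definition interp_code (codeM : {n & M n} -> nat) (f : interp_univ) : nat :=
  codeM (existT _ (prop_ar (iU I)) (sval f)).

End Interpretation.

Arguments interp_struct {S M} I R : rename.

Fact lex_enum_subproof r h (j : 'I_(r ^ h)) (i : 'I_h) :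
  (j %/ r ^ (h - i.+1)) %% r < r.
Proof.
apply: ltn_pmod; case: r j => // -[j].
by case: h i => [[]//|h i]; rewrite exp0n.
Qed.

(* The j-th map [h] -> [r] in lexicographic order lists the h digits of j in
   base r, most significant first. *)
Definition lex_enum r h (j : 'I_(r ^ h)) (i : 'I_h) : 'I_r :=
  Ordinal (lex_enum_subproof j i).

Fact lex_enum_lt r h (j k : 'I_(r ^ h)) : j < k ->
  exists2 i : 'I_h, forall i' : 'I_h, i' < i -> lex_enum j i' = lex_enum k i'
                  & lex_enum j i < lex_enum k i.
Proof.
move=> jk.
have h0 : 0 < h.
  by case: h j k jk => // -[j jlt] [k klt] /=; move: j k jlt klt => [|?] [|?].
pose d i := j %/ r ^ (h - i.+1) != k %/ r ^ (h - i.+1).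
have exd : exists i, d i.
  by exists h.-1; rewrite /d prednK // subnn expn0 !divn1 neq_ltn jk.
have [i di imin] := ex_minnP exd.
have ih : i < h.
  rewrite ltnNge; apply/negP => hi; have := imin h.-1.
  rewrite /d prednK // subnn expn0 !divn1 neq_ltn jk => /(_ isT).
  by rewrite leqNgt (leq_trans _ hi) // ltn_predL.
have eqd i' : i' < i -> j %/ r ^ (h - i'.+1) = k %/ r ^ (h - i'.+1).
  by move=> i'i; apply/eqP/negPn/negP => /imin; rewrite leqNgt i'i.
exists (Ordinal ih) => [i' i'i|]; first by apply/val_inj; rewrite /= eqd.
rewrite /=.
have lt : j %/ r ^ (h - i.+1) < k %/ r ^ (h - i.+1).
  by rewrite ltn_neqAle -/(d i) di leq_div2r // ltnW.
have eqr : j %/ r ^ (h - i.+1) %/ r = k %/ r ^ (h - i.+1) %/ r.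
  rewrite -!divnMA -expnSr -subSn // subSS.
  case: i {di imin lt} ih eqd => [|i] ih eqd; last by rewrite eqd.
  by rewrite subn0 !divn_small.
move: lt; rewrite [X in X < _](divn_eq _ r) [X in _ < X](divn_eq _ r) eqr.
by rewrite ltn_add2l.
Qed.

Definition K_sig (h r : nat) : signature := Signature (fun _ : unit => r ^ h).

Definition K (h r : nat) : structure (K_sig h r) 'I_r :=
  fun _ t => exists i : 'I_h, t = fun j : 'I_(r ^ h) => lex_enum j i.

Arguments K h r : clear implicits.

(* Main.v *)
(** Compactness turns [G -> T] into a homomorphism [t] from [interp_struct I] to
    [T].  Colour the [r]-ary elements of [M] by finitely many colours that
    determine both the class modulo [D] and the [t]-values of the minors lying in
    [iU I], and let [B] be the resulting finite quotient of the free structure of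
    [M] generated by [K h r].  Sending [f] to [b |-> colour (minor b f)] is a
    minion homomorphism from [M] to [Pol (K h r) B].  Conversely, any minion
    homomorphism to [Pol (K h r) B] lifts, up to arity [h], to a choice of
    representatives that is a partial homomorphism to [M / D]; by internality it
    preserves the interpretation, so composing [G -> interp_struct I] with it and
    with [t] is a homomorphism from [G] to [T].  This composite only depends on
    the table of a polymorphism of fixed arity, of which there are finitely many,
    hence it would be computable if the minion homomorphism were. *)
Require Import Defs.
From mathcomp Require Import all_boot.
From mathcomp Require Import boolp classical_sets cardinality.

Set Implicit Arguments.
Unset Strict Implicit.
Unset Printing Implicit Defensive.

Local Open Scope classical_set_scope.

(** * Programs for functions given by a finite table *)

Fixpoint prec_const n (c : nat) : precfun n :=
  if c is c'.+1 then Comp Succ (fun=> prec_const n c') else Zero n.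

Lemma computes_const n c (v : n.-tuple nat) : computes (prec_const n c) v c.
Proof.
elim: c => //= c IHc; exists [tuple c] => [i|//].
by rewrite [i]ord1 tnth0.
Qed.

(** Primitive recursion serves only as a case split on zero: the step ignores the previous value and
    looks up the counter in the tail. *)
Fixpoint prec_table (s : seq nat) : precfun 1 :=
  if s is c :: s' then
    PrimRec (prec_const 0 c) (Comp (prec_table s') (fun=> Proj ord0))
  else Zero 1.

Lemma computes_table s x : computes (prec_table s) [tuple x] (nth 0 s x).
Proof.
elim: s x => [|c s IHs] x /=; first by rewrite nth_nil.
exists (nth 0 (c :: s)); split=> // [|k _]; first exact: computes_const.
exists [tuple k] => [i|]; last exact: IHs.
by rewrite [i]ord1 /= !tnth0.
Qed.

(** On codes, [k] is some function [H] of the code of [f x]. [H] need not be given effectively: only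
    its values below [N] matter, and these fit in a table. *)
Lemma computable_bounded_factor (X Y Z : Type) (codeX : X -> nat)
    (codeY : Y -> nat) (codeZ : Z -> nat) (f : X -> Y) (k : X -> Z) (N : nat) :
    computable codeX codeY f -> (forall x, codeY (f x) < N) ->
    (forall x x', codeY (f x) = codeY (f x') -> k x = k x') ->
  computable codeX codeZ k.
Proof.
move=> [e eP] ltN fk.
have [H HP] : exists H : nat -> nat, forall x, H (codeY (f x)) = codeZ (k x).
  have /choice[H HP] c : exists z, forall x, codeY (f x) = c -> z = codeZ (k x).
    have [[x <-]|nx] := pselect (exists x, codeY (f x) = c).
      by exists (codeZ (k x)) => x' /fk ->.
    by exists 0 => x xc; case: nx; exists x.
  by exists H => x; apply: HP.
exists (Comp (prec_table (mkseq H N)) (fun=> e)) => x /=.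
exists [tuple codeY (f x)] => [i|]; first by rewrite [i]ord1 tnth0.
by rewrite -HP -(nth_mkseq 0 H (ltN x)); apply: computes_table.
Qed.

(** * Compactness for homomorphisms to a finite structure *)

(** The branch grows letter by letter through prefixes that extend to a good sequence at every
    level. If each letter [a] failed at a level [N a], a sequence good at the maximum of these
    levels would contradict the failure of its own next letter. *)
Lemma weak_konig (T : finType) (good : nat -> (nat -> T) -> Prop) :
    (forall m n s, m <= n -> good n s -> good m s) ->
    (forall n, exists s, good n s) ->
  exists s, forall k n, exists2 s', good n s' & forall i, i < k -> s' i = s i.
Proof.
move=> anti ex.
pose ext (l : seq T) := forall n, exists2 s, good n s & mkseq s (size l) = l.
have ext0 : ext [::] by move=> n; have [s ?] := ex n; exists s.
have step l : exists a, ext l -> ext (rcons l a).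
  have [el|/existsNP[n nl]] := pselect (ext l); last first.
    by have [s _] := ex 0; exists (s 0) => /(_ n).
  apply/not_existsP => nx.
  have /choice[N NP] a : exists n, forall s, good n s ->
      mkseq s (size (rcons l a)) <> rcons l a.
    have /not_implyP[_ /existsNP[n nn]] := nx a.
    by exists n => s gs sl; apply: nn; exists s.
  have [s gs sl] := el (\max_a N a).
  apply: (NP (s (size l)) s); first by apply: anti gs; apply: leq_bigmax.
  by rewrite size_rcons mkseqS sl.
have [a aP] := choice step.
pose L k := iter k (fun l => rcons l (a l)) [::].
have extL k : ext (L k) by elim: k => //= k IHk; apply: aP.
have sizeL k : size (L k) = k by elim: k => //= k IHk; rewrite size_rcons IHk.
have LE k : L k = mkseq (fun k => a (L k)) k.
  by elim: k => // k IHk; rewrite mkseqS -IHk.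
exists (fun k => a (L k)) => k n.
have [s gs sl] := extL k n; exists s => // i ik.
have [x0] : exists x0 : T, True by exists (s 0).
by move: sl; rewrite sizeL LE => /(congr1 (nth x0 ^~ i)); rewrite !nth_mkseq.
Qed.

Lemma compactness_hom (S : signature) (A : Type) (T : finType)
    (SA : structure S A) (ST : structure S T) (code : A -> nat) (a0 : A) :
    injective code -> T ->
    (forall (X : finType) (SX : structure S X), maps_to SX SA -> maps_to SX ST) ->
  maps_to SA ST.
Proof.
move=> code_inj t0 fin.
pose good n (s : nat -> T) := forall R (x : 'I_(sym_ar R) -> A), SA R x ->
  (forall j, code (x j) < n) -> ST R (s \o code \o x).
have [] := @weak_konig T good.
- move=> m n s mn gs R x xR xm; apply: gs => // j.
  exact: leq_trans (xm j) mn.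
- move=> n.
  (* The part of [SA] on elements with code below [n], transported to codes. Numbers that code
     nothing occur in no tuple and are sent to [a0]. *)
  pose SX : structure S 'I_n := fun R t =>
    exists2 x : 'I_(sym_ar R) -> A, SA R x & forall j, code (x j) = t j.
  have [|f fP] := fin 'I_n SX.
    have /choice[d dP] (i : 'I_n) : exists a, forall a', code a' = i -> a = a'.
      have [[a ai]|na] := pselect (exists a, code a = i).
        by exists a => a' a'i; apply: code_inj; rewrite a'i.
      by exists a0 => a ai; case: na; exists a.
    exists d => R t [x xR xt].
    suff -> : d \o t = x by [].
    by apply: funext => j; apply: dP.
  exists (fun i => if insub i is Some j then f j else t0) => R x xR xn.
  have -> : (fun i => if insub i is Some j then f j else t0) \o code \o x =
      f \o (fun j => Ordinal (xn j)).
    by apply: funext => j /=; rewrite (insubT (fun i => i < n) (xn j)).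
  by apply: fP; exists x.
move=> s sP; exists (s \o code) => R x xR.
(* A tuple has finitely many entries, so a finite prefix of [s] decides its image. *)
have lt j : code (x j) < (\max_j code (x j)).+1.
  by rewrite ltnS; apply: (leq_bigmax (F := fun j => code (x j))).
have [s' gs' ss'] := sP (\max_j code (x j)).+1 (\max_j code (x j)).+1.
have -> : s \o code \o x = s' \o code \o x.
  by apply: funext => j /=; rewrite ss'.
exact: gs'.
Qed.

(** * Polymorphisms obtained from a colouring *)

Lemma lex_enum_surj r h (b : 'I_h -> 'I_r) : exists j, lex_enum j = b.
Proof.
pose L (j : 'I_(r ^ h)) := [ffun i => lex_enum j i].
have L_inj : injective L.
  move=> j k /ffunP jk; apply/val_inj/eqP; apply: contraT.
  rewrite neq_ltn => /orP[] /lex_enum_lt[i _].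
    by have := jk i; rewrite !ffunE => ->; rewrite ltnn.
  by have := jk i; rewrite !ffunE => ->; rewrite ltnn.
have /(inj_card_onto L_inj) : #|{ffun 'I_h -> 'I_r}| <= #|'I_(r ^ h)|.
  by rewrite card_ffun !card_ord.
move=> /(_ [ffun i => b i])/codomP[j jb]; exists j; apply: funext => i.
by have /ffunP/(_ i) := jb; rewrite !ffunE.
Qed.

Lemma widen_ord_retraction n m (le_nm : n <= m) : 0 < n ->
  exists s : 'I_m -> 'I_n, s \o widen_ord le_nm = id.
Proof.
move=> n0; exists (fun i => insubd (Ordinal n0) (val i)).
by apply: funext => i; apply/val_inj; rewrite /= val_insubd ltn_ord.
Qed.

Section Colouring.
Variables (M : minion) (h r : nat) (B : finType) (colour : M r -> B).

(* The image under [colour] of the relation of the free structure of [M]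
   generated by [K h r]. *)
Definition colour_struct : structure (K_sig h r) B := fun _ t =>
  exists g : M h, t = fun j : 'I_(r ^ h) => colour (minor (lex_enum j) g).

Fact colour_pol_subproof n (f : M n) :
  0 < n /\ is_hom (power (K h r) n) colour_struct (fun b => colour (minor b f)).
Proof.
split=> [|R t /choice[k kP]]; first exact: elt_gt0 f.
exists (minor k f); apply: funext => j /=.
rewrite -minor_comp; congr (colour (minor _ f)); apply: funext => i /=.
exact: (congr1 (@^~ j) (kP i)).
Qed.

Definition colour_pol n (f : M n) : Pol (K h r) colour_struct n :=
  exist _ (fun b => colour (minor b f)) (colour_pol_subproof f).

Lemma colour_pol_hom : is_minion_hom colour_pol.
Proof.
move=> n m p f; apply: eq_exist; apply: funext => b /=.
by rewrite minor_comp.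
Qed.

Lemma maps_to_colour_struct n : M n -> maps_to (K h r) colour_struct.
Proof.
move=> f; exists (fun a => sval (colour_pol f) (fun=> a)) => R t tK.
by apply: (proj2 (svalP (colour_pol f)) R (fun j _ => t j)).
Qed.

(** Since [n <= h], all maps from ['I_n] to ['I_r] occur in one tuple of the power of [K h r], so a
    single application of [phi] to it captures the whole table. Its image comes from some [g0] of
    arity [h], brought down to arity [n] by a retraction. *)
Lemma colour_pol_rep n (phi : Pol (K h r) colour_struct n) : n <= h ->
  exists g : M n, forall b, sval phi b = colour (minor b g).
Proof.
move=> nh; have [s sK] := widen_ord_retraction nh (elt_gt0 phi).
have [|g0 g0P] :=
    proj2 (svalP phi) tt (fun j => lex_enum j \o widen_ord nh).
  by move=> i; exists (widen_ord nh i).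
exists (minor s g0) => b; have [j jb] := lex_enum_surj (b \o s).
rewrite -minor_comp -jb.
have <- := congr1 (@^~ j) g0P; rewrite /= jb.
by rewrite -compA sK.
Qed.

End Colouring.

(** * Classes modulo a description, and encodings *)

Lemma deq_colouring (M : minion) (D : description M) (r : nat) :
    finite_set D -> (forall Q, D Q -> prop_ar Q <= r) ->
  exists (B : finType) (c : M r -> B), forall x y, c x = c y -> deq D x y.
Proof.
move=> [N DN] Dr.
have [idx idx_lt idx_inj] : exists2 idx : property M -> nat,
    forall P, D P -> idx P < N & {in D &, injective idx}.
  by have /card_set_bijP[f [fD f_inj _]] := DN; exists f.
(* The colour lists which minors of [x] lie in which properties. Properties are replaced by indices
   and minoring maps are widened to ['I_r], so that a single finite type indexes all the tests. *)
pose c (x : M r) := [ffun ks : 'I_N * {ffun 'I_r -> 'I_r} =>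
  `[< exists P : property M, [/\ D P, idx P = ks.1 &
      exists2 p : 'I_r -> 'I_(prop_ar P),
        forall i, p i = ks.2 i :> nat & prop_set P (minor p x)] >]].
exists {ffun 'I_N * {ffun 'I_r -> 'I_r} -> bool}, c => x y cxy.
suff half (x' y' : M r) : c x' = c y' -> forall P, D P ->
    forall p, prop_set P (minor p x') -> prop_set P (minor p y').
  by move=> P DP p; split; apply: half.
move=> {}cxy P DP p Px.
pose k := (Ordinal (idx_lt P DP), [ffun i => widen_ord (Dr P DP) (p i)]).
have /ffunP/(_ k) := cxy; rewrite !ffunE => cxyk.
have [+ _] := asbool_eq_equiv cxyk; case.
  by exists P; split=> //; exists p => // i; rewrite ffunE.
move=> P' [DP' idxP [p' p'E Py]].
have eqP : P' = P by apply: idx_inj => //; apply/mem_set.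
subst P'; suff -> : p = p' by [].
by apply: funext => i; apply: ord_inj; rewrite p'E ffunE.
Qed.

Lemma stable_deq (M : minion) (D : description M) (Q : property M) f g :
  stable D Q -> prop_set Q f -> deq D f g -> prop_set Q g.
Proof.
move=> [C Crange ->] [X CX Xf] fg; exists X => //.
have [k _ kX] := Crange X CX; rewrite -kX in Xf *.
exact: deq_trans fg.
Qed.

Lemma qproj_eq (M : minion) (D : description M) n (f g : M n) :
  qproj D f = qproj D g <-> deq D f g.
Proof.
split=> [/(congr1 sval) /= fg|fg].
  by have : dclass D g g by []; rewrite -fg.
apply: eq_exist; apply/seteqP; split=> k; apply: deq_trans => //.
exact: deq_sym.
Qed.

Lemma qproj_minor (M : minion) (D : description M) n m (p : 'I_n -> 'I_m)
    (f : M n) : minor p (qproj D f : quotient D n) = qproj D (minor p f).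
Proof. by apply: eq_exist; rewrite /= class_minor_dclass. Qed.

(** Followed by [qproj], [rep] is a partial homomorphism to the quotient; internality then gives
    membership up to [deq], and stability removes this proviso. *)
Lemma internal_rep (M : minion) (D : description M) h (Q : property M)
    (rep : forall n, M n -> M n) :
    (forall n m (p : 'I_n -> 'I_m) (f : M n), n <= h -> m <= h ->
       deq D (rep m (minor p f)) (minor p (rep n f))) ->
    internal D h Q -> forall f, prop_set Q f -> prop_set Q (rep _ f).
Proof.
move=> repM [stQ [hQ intQ]] f Qf.
have [|f' Qf' /qproj_eq] :=
    intQ (fun n _ f => qproj D (rep n f)) _ _ (ex_intro2 _ _ f Qf erefl).
  by move=> n m hn hm p g; rewrite qproj_minor; apply/qproj_eq/repM.
exact: stable_deq.
Qed.

(** Every map to ['I_(prop_ar P)] factors through ['I_r]. *)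
Lemma deq_minor_widen (M : minion) (D : description M) r n (x y : M n) :
    (forall Q, D Q -> prop_ar Q <= r) ->
    (forall b : 'I_n -> 'I_r, deq D (minor b x) (minor b y)) -> deq D x y.
Proof.
move=> Dr xy P DP q.
have ar_gt0 : 0 < prop_ar P.
  by apply: leq_trans (ltn_ord (q (Ordinal (elt_gt0 x)))).
have [s sK] := widen_ord_retraction (Dr P DP) ar_gt0.
have := xy (widen_ord (Dr P DP) \o q) P DP s.
by rewrite -!minor_comp compA sK.
Qed.

Lemma interp_code_inj (S : signature) (M : minion) (I : interpretation S M)
    (codeM : {n & M n} -> nat) :
  injective codeM -> injective (@interp_code S M I codeM).
Proof.
move=> codeM_inj [f Uf] [g Ug] /codeM_inj fg.
apply: eq_exist; exact: (@eq_from_Tagged _ M _ f g fg).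
Qed.

Lemma pol_code_inj (S : signature) (A B : finType) (SA : structure S A)
    (SB : structure S B) n (f g : Pol SA SB n) :
  pol_code (existT _ n f) = pol_code (existT _ n g) -> sval f = sval g.
Proof.
move=> /(pcan_inj pickleK)[] /(pcan_inj pickleK)/ffunP fg; apply: funext => b.
have -> : b = [ffun i => b i] by apply: funext => i; rewrite ffunE.
by have := fg [ffun i => b i]; rewrite !ffunE.
Qed.

Lemma pol_code_bounded (S : signature) (A B : finType) (SA : structure S A)
    (SB : structure S B) n :
  exists N, forall f : Pol SA SB n, pol_code (existT _ n f) < N.
Proof.
pose code (t : {ffun {ffun 'I_n -> A} -> B}) := pickle (n, pickle t).
by exists (\max_t code t).+1 => f; rewrite ltnS; apply: (leq_bigmax (F := code)).
Qed.

Lemma partial_colouring (X : Type) (T : finType) (U : set X) (t : {x | U x} -> T) :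
  exists c : X -> option T, forall x (Ux : U x), c x = Some (t (exist _ x Ux)).
Proof.
exists (fun x => if pselect (U x) is left Ux then Some (t (exist _ x Ux)) else None).
move=> x Ux; case: pselect => // Ux'; congr (Some (t _)); exact: eq_exist.
Qed.

(** * From a minion homomorphism back to a homomorphism into [T] *)

Section HomFromPol.
Variables (S : signature) (M : minion) (D : description M).
Variables (I : interpretation S M) (h r : nat) (T B : finType).
Variables (ST : structure S T) (t : interp_univ I -> T) (colour : M r -> B).
Hypotheses (intI : internal_interp I D h) (Dr : forall Q, D Q -> prop_ar Q <= r).
Hypothesis Ur : prop_ar (iU I) <= r.
Hypothesis t_hom : is_hom (interp_struct I) ST t.
Hypothesis colourD : forall x y, colour x = colour y -> deq D x y.
Hypothesis colourT : forall x y, colour x = colour y ->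
  forall (s : 'I_r -> 'I_(prop_ar (iU I))) Ux Uy,
    t (exist _ (minor s x) Ux) = t (exist _ (minor s y) Uy).
Variable F : forall n, M n -> Pol (K h r) (@colour_struct M h r B colour) n.
Hypothesis F_hom : is_minion_hom F.

Lemma hom_from_pol : exists2 k : interp_univ I -> T, is_hom (interp_struct I) ST k &
  forall x y, sval (F (sval x)) = sval (F (sval y)) -> k x = k y.
Proof.
(* Above arity [h] the choice is arbitrary; [f] is a default. *)
have ex n (f : M n) : exists g, n <= h ->
    forall b, sval (F f) b = colour (minor b g).
  have [nh|nh] := pselect (n <= h); last by exists f.
  by have [g gP] := colour_pol_rep (F f) nh; exists g.
pose rep n (f : M n) := sval (cid (ex n f)).
have repP n (f : M n) : n <= h -> forall b, sval (F f) b = colour (minor b (rep n f)).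
  exact: svalP (cid (ex n f)).
have repM n m (p : 'I_n -> 'I_m) (f : M n) : n <= h -> m <= h ->
    deq D (rep m (minor p f)) (minor p (rep n f)).
  move=> nh mh; apply: (deq_minor_widen Dr) => b; apply: colourD.
  by rewrite -repP // F_hom -minor_comp -repP.
have [intU intR] := intI.
have repU := internal_rep repM intU.
have Uh : prop_ar (iU I) <= h by case: intU => _ [].
(* [t] depends only on the colours of [r]-ary minors, because an element of [iU I] is itself a minor
   of its widening to arity [r]. *)
have k_eq x y Ux Uy : (forall b, colour (minor b x) = colour (minor b y)) ->
    t (exist _ x Ux) = t (exist _ y Uy).
  move=> xy; have [s sK] := widen_ord_retraction Ur (elt_gt0 x).
  have idE (z : M (prop_ar (iU I))) : z = minor s (minor (widen_ord Ur) z).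
    by rewrite -minor_comp sK minor_id.
  move: Ux Uy; rewrite [x]idE [y]idE => Ux Uy.
  exact: colourT.
exists (fun x => t (exist _ (rep _ (sval x)) (repU _ (svalP x)))).
  move=> R x [g Rg gx].
  have Rg' := internal_rep repM (intR R) Rg.
  have Rh : prop_ar (iR I R) <= h by case: (intR R) => _ [].
  (* The minors of [rep g] need not equal the representatives of the [x i], but they are equivalent
     to them modulo [D], and [iU I] is stable. *)
  have Ug' i : prop_set (iU I) (minor (iPi (i := I) i) (rep _ g)).
    apply: stable_deq intU.1 (repU _ (svalP (x i))) _.
    by rewrite -gx; apply: repM.
  have : interp_struct I R (fun i => exist _ _ (Ug' i)) by exists (rep _ g).
  move=> /t_hom; congr (ST _); apply: funext => i /=.
  (* Both sides have the colours prescribed by the polymorphism [F (sval (x i))]. *)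
  apply: k_eq => b.
  by rewrite -minor_comp -!repP // -gx F_hom.
move=> x y Fxy.
by apply: k_eq => b; rewrite -!repP // Fxy.
Qed.

End HomFromPol.

Theorem theorem7p6
    (S : signature) (G : Type) (SG : structure S G)
    (codeG : G -> nat) (codeG_inj : injective codeG)
    (M : minion) (codeM : {n : nat & M n} -> nat) (codeM_inj : injective codeM)
    (D : description M) (D_fin : finite_set D)
    (I : interpretation S M) (h r : nat) (le_rh : r <= h)
    (H1 : exists (T : finType) (ST : structure S T),
        maps_to SG ST /\
        ~ (exists f : G -> T, is_hom SG ST f /\ computable codeG pickle f))
    (H2 : internal_interp I D h)
    (H3 : finitely_equivalent (interp_struct I) SG)
    (H4 : exists f : G -> interp_univ I,
        is_hom SG (interp_struct I) f /\
        computable codeG (interp_code codeM) f)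
    (H5 : (forall Q : property M, D Q -> prop_ar Q <= r) /\
          prop_ar (iU I) <= r) :
  exists (B : finType) (SB : structure (K_sig h r) B),
    [/\ maps_to (K h r) SB,
        exists F : forall n, M n -> Pol (K h r) SB n, is_minion_hom F
      & ~ (exists F : forall n, M n -> Pol (K h r) SB n,
             is_minion_hom F /\
             computable_minion_map codeM (@pol_code (K_sig h r) 'I_r B (K h r) SB) F)].
Proof.
have [T [ST [[fT fT_hom] noT]]] := H1.
have [fI [fI_hom fI_comp]] := H4.
have [Dr Ur] := H5.
(* If [G] is empty, any program computes [fT] vacuously, against the choice of [T]. *)
have [[g0 _]|G0] := pselect (exists g : G, True); last first.
  case: noT; exists fT; split=> //; exists (Zero 1) => x.
  by case: G0; exists x.
have [t t_hom] : maps_to (interp_struct I) ST.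
  apply: (compactness_hom (fI g0) (interp_code_inj codeM_inj) (fT g0)) => X SX.
  move=> /H3[k k_hom]; exists (fT \o k) => R x xX.
  exact/fT_hom/k_hom.
have [B0 [c0 c0P]] := deq_colouring D_fin Dr.
have [cT cTP] := partial_colouring t.
(* The second component records the [t]-value of each minor of [x] of the arity of [iU I], as [Some]
   whenever the minor lies in [iU I]. *)
pose colour (x : M r) :=
  (c0 x, [ffun s : {ffun 'I_r -> 'I_(prop_ar (iU I))} => cT (minor s x)]).
exists _, (@colour_struct M h r _ colour); split.
- exact: maps_to_colour_struct (sval (fI g0)).
- by exists (colour_pol h colour); apply: colour_pol_hom.
move=> [F [F_hom F_comp]].
have [||k k_hom kF] := hom_from_pol H2 Dr Ur t_hom _ _ F_hom.
- by move=> x y [/c0P].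
- move=> x y [_ /ffunP xy] s Ux Uy; apply: Some_inj; rewrite -!cTP.
  have := xy (finfun s); rewrite !ffunE.
  by have -> : finfun s = s :> (_ -> _) by apply: funext => i; rewrite ffunE.
have [N NP] := pol_code_bounded (K h r) (colour_struct colour) (prop_ar (iU I)).
apply: noT; exists (k \o fI); split.
  by move=> R x xG; apply/k_hom/fI_hom.
have F_comp' : computable codeG (@pol_code _ _ _ (K h r) (colour_struct colour))
    (fun x => existT _ _ (F _ (sval (fI x)))).
  move: fI_comp F_comp => [e1 e1P] [e2 e2P].
  exists (Comp e2 (fun=> e1)) => x /=.
  exists [tuple interp_code codeM (fI x)] => [i|].
    by rewrite [i]ord1 tnth0.
  exact: (e2P (existT _ _ (sval (fI x)))).
(* [k \o fI] is determined by the code of a polymorphism of the fixed arity of [iU I], and such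
   codes are bounded by [N]. *)
apply: computable_bounded_factor F_comp' (fun x => NP _) _ => x y /pol_code_inj.
exact: kF.
Qed.
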